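(* Suppose that $\mathcal P$ is proper (all closed bounded subsets are compact) and $\Omega\subset\mathcal P$ is open. Assume that $X$ is a quasi-Banach function lattice over $(\mathcal P,\mu)$ with absolutely continuous quasi-norm and such that $\|\chi_E\|_X<\infty$ for every measurable set $E\subset\mathcal P$ with $\mu(E)<\infty$. If locally Lipschitz functions are dense in $N^1X=N^1X(\mathcal P)$ (i.e. the locally Lipschitz functions belonging to $N^1X$ are dense in it), then locally Lipschitz functions are dense in $N^1X(\Omega)$.
   Context: Setting. $\mathcal P=(\mathcal P,\mathrm d,\mu)$ is a metric space with a $\sigma$-finite Borel regular measure $\mu$ (all Borel sets are $\mu$-measurable, and every $\mu$-measurable set $A$ is contained in a Borel set $D$ with $\mu(D)=\mu(A)$) such that every ball has finite positive measure. $\mathcal M(\mathcal P,\mu)$ is the set of all extended real-valued $\mu$-measurable functions on $\mathcal P$ (defined everywhere). Quasi-Banach function lattice: a linear space $X=\{u\in\mathcal M(\mathcal P,\mu):\|u\|_X<\infty\}$ given by a functional $\|\cdot\|_X:\mathcal M(\mathcal P,\mu)\to[0,\infty]$ such that: $\|u\|_X=0$ iff $u=0$ a.e.; $\|au\|_X=|a|\,\|u\|_X$ for $a\in\mathbb R$; there is a constant $c_\triangle\ge1$ (modulus of concavity) with $\|u+v\|_X\le c_\triangle(\|u\|_X+\|v\|_X)$; if $|u|\le|v|$ a.e. then $\|u\|_X\le\|v\|_X$; and (Riesz--Fischer) if $u_n\ge0$ a.e. for all $n$ then $\|\sum_{n=1}^\infty u_n\|_X\le\sum_{n=1}^\infty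 c_\triangle^n\|u_n\|_X$. The quasi-norm is also assumed continuous: $\|u_n-u\|_X\to0$ implies $\|u_n\|_X\to\|u\|_X$. The quasi-norm is absolutely continuous if for every $u\in X$, $\|u\chi_{E_n}\|_X\to0$ whenever $\{E_n\}$ is a decreasing sequence of measurable sets with $\mu(\bigcap_nE_n)=0$. Newtonian space. A curve is a non-constant continuous map $\gamma$ from a compact interval into $\mathcal P$ of finite length, parametrized by arc length $ds$ on $[0,l_\gamma]$. A Borel function $g:\mathcal P\to[0,\infty]$ is an upper gradient of $u:\mathcal P\to[-\infty,\infty]$ if $|u(\gamma(0))-u(\gamma(l_\gamma))|\le\int_\gamma g\,ds$ for every curve $\gamma$, with the convention $|(\pm\infty)-(\pm\infty)|=\infty$. Set $\|u\|_{N^1X}=\|u\|_X+\inf_g\|g\|_X$, infimum over all upper gradients $g$ of $u$, and $N^1X=\{u\in\mathcal M(\mathcal P,\mu):\|u\|_{N^1X}<\infty\}$ (a quasi-seminormed space of everywhere defined functions). $N^1X(\Omega)$ is the Newtonian space defined in the same way with the metric measure space $\Omega$ (metric and measure restricted from $\mathcal P$, curves in $\Omega$) in place of $\mathcal P$, and with the quasi-norm $\|u\|_{X(\Omega)}=\|\hat u\|_X$ for measurable $u$ on $\Omega$, where $\hat u$ is the extension of $u$ by zero to $\mathcal P$. A function is locally Lipschitz if every point has a neighbourhood in which it is Lipschitz. *)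

(* Defs.v *)
From HB Require Import structures.
From mathcomp Require Import all_boot all_order all_algebra.
From mathcomp Require Import all_classical all_reals all_analysis.
From mathcomp Require Import measurable_realfun.

Set Implicit Arguments.
Unset Strict Implicit.
Unset Printing Implicit Defensive.

Import Order.TTheory GRing.Theory Num.Theory.
Import numFieldTopology.Exports numFieldNormedType.Exports.

Local Open Scope classical_set_scope.
Local Open Scope ring_scope.

(* A metric space with a sigma-algebra on the same carrier.  No compatibility
   is required here: the sigma-algebra is that of the mu-measurable sets, and
   its relation to the Borel sets is part of [Borel_regular]. *)
#[short(type="metricMeasurableType")]
HB.structure Definition MetricMeasurable (R : realType) (d : measure_display) :=
  {T of Metric R T & Measurable d T}.

Section metric_notions.
Context {R : realType} {P : metricType R}.

Definition Borel_set (B : set P) : Prop := <<s @open P >> B.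

Definition proper_space : Prop := forall A : set P,
  closed A -> (exists x r, A `<=` ball x r) -> compact A.

Definition locally_Lipschitz (D : set P) (v : P -> R) : Prop :=
  forall x, D x -> exists U L, nbhs x U /\
    forall y z, (D `&` U) y -> (D `&` U) z -> `|v y - v z| <= L * mdist y z.

(* [s] lists the points of the partition other than the left endpoint [a]. *)
Definition curve_length (a b : R) (gamma : R -> P) : \bar R :=
  ereal_sup [set (\sum_(i < size s)
                    mdist (gamma (nth b (a :: s) i)) (gamma (nth b s i)))%:E
            | s in itv_partition a b].

(* A curve of length [l] in [D], parametrized by arc length on [0, l]; only
   the values of [gamma] on [0, l] matter.  In this parametrization the curve
   is non-constant exactly when [0 < l]. *)
Definition arc_length_curve (D : set P) (l : R) (gamma : R -> P) : Prop :=
  [/\ 0 < l,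
      {within `[0, l], continuous gamma},
      (forall s : R, s \in `[0, l] -> D (gamma s)) &
      forall s : R, s \in `[0, l] -> curve_length 0 s gamma = s%:E].

Definition curve_integral (l : R) (gamma : R -> P) (g : P -> \bar R) : \bar R :=
  (\int[lebesgue_measure]_(s in `[0%R, l]) g (gamma s))%E.

End metric_notions.
Arguments proper_space {R} P.

Section metric_measure_notions.
Context {R : realType} {d : measure_display} {P : metricMeasurableType R d}.

(* Functions on [D] are total functions on [P] whose values off [D] are
   ignored; [D] is meant to be open, so that its own Borel sets are the Borel
   sets of [P] contained in [D].  The convention |(+-oo) - (+-oo)| = +oo is
   what [`|x - y|] evaluates to in [\bar R]. *)
Definition upper_gradient (D : set P) (u g : P -> \bar R) : Prop :=
  [/\ measurable_fun (D : set (g_sigma_algebraType (@open P)))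
        (g : g_sigma_algebraType (@open P) -> \bar R),
      (forall x, D x -> 0 <= g x)%E &
      forall (l : R) (gamma : R -> P), arc_length_curve D l gamma ->
        (`| u (gamma 0%R) - u (gamma l) | <= curve_integral l gamma g)%E].

Definition Borel_regular (mu : {measure set P -> \bar R}) : Prop :=
  (forall B : set P, Borel_set B -> measurable B) /\
  (forall A : set P, measurable A ->
     exists B : set P, [/\ Borel_set B, A `<=` B & mu B = mu A]).

Definition balls_finite_positive (mu : {measure set P -> \bar R}) : Prop :=
  forall (x : P) (r : R), 0 < r -> (0 < mu (ball x r) < +oo)%E.

(* [nX] is only constrained on measurable functions.  Where an undefined sum
   (+oo) + (-oo) may occur, either it occurs on a null set or the right-hand
   side of the inequality is +oo, so its conventional value is immaterial. *)
Record quasi_Banach_function_lattice (mu : {measure set P -> \bar R})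
    (c : R) (nX : (P -> \bar R) -> \bar R) : Prop := {
  qB_ge0 : forall u : P -> \bar R, measurable_fun setT u -> (0 <= nX u)%E ;
  qB_eq0 : forall u : P -> \bar R, measurable_fun setT u ->
    (nX u = 0%E <-> {ae mu, forall x, u x = 0%E}) ;
  qB_homogeneous : forall (a : R) (u : P -> \bar R), measurable_fun setT u ->
    nX (fun x => a%:E * u x)%E = (`|a|%:E * nX u)%E ;
  qB_concavity_ge1 : 1 <= c ;
  qB_triangle : forall u v : P -> \bar R,
    measurable_fun setT u -> measurable_fun setT v ->
    (nX (fun x => u x + v x) <= c%:E * (nX u + nX v))%E ;
  qB_lattice : forall u v : P -> \bar R,
    measurable_fun setT u -> measurable_fun setT v ->
    {ae mu, forall x, (`|u x| <= `|v x|)%E} -> (nX u <= nX v)%E ;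
  (* indexed from 0, whence the exponent n.+1 *)
  qB_Riesz_Fischer : forall u : (P -> \bar R)^nat,
    (forall n, measurable_fun setT (u n)) ->
    (forall n, {ae mu, forall x, (0 <= u n x)%E}) ->
    (nX (fun x => \sum_(0 <= n <oo) u n x)
       <= \sum_(0 <= n <oo) (c ^+ n.+1)%:E * nX (u n))%E ;
  qB_continuous : forall (u_ : (P -> \bar R)^nat) (u : P -> \bar R),
    (forall n, measurable_fun setT (u_ n) /\ (nX (u_ n) < +oo)%E) ->
    measurable_fun setT u -> (nX u < +oo)%E ->
    nX (fun x => u_ n x - u x)%E @[n --> \oo] --> 0%E ->
    nX (u_ n) @[n --> \oo] --> nX u }.

Definition absolutely_continuous_quasinorm (mu : {measure set P -> \bar R})
    (nX : (P -> \bar R) -> \bar R) : Prop :=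
  forall u : P -> \bar R, measurable_fun setT u -> (nX u < +oo)%E ->
  forall E : (set P)^nat,
    (forall n, measurable (E n)) -> nonincreasing_seq E ->
    mu (\bigcap_n E n) = 0%E ->
    nX (u \_ (E n)) @[n --> \oo] --> 0%E.

(* The Newtonian space N^1X(D) over an open set [D], with the quasi-norm of the
   extension by zero [u \_ D]; N^1X is the case [D := setT]. *)
Definition N1norm (nX : (P -> \bar R) -> \bar R) (D : set P)
    (u : P -> \bar R) : \bar R :=
  (nX (u \_ D) + ereal_inf [set nX (g \_ D) | g in upper_gradient D u])%E.

Definition N1X (nX : (P -> \bar R) -> \bar R) (D : set P)
    : set (P -> \bar R) :=
  [set u | measurable_fun D u /\ (N1norm nX D u < +oo)%E].

Definition locally_Lipschitz_dense (nX : (P -> \bar R) -> \bar R)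
    (D : set P) : Prop :=
  forall u, N1X nX D u -> forall e : R, 0 < e ->
  exists v : P -> R, [/\ locally_Lipschitz D v,
    N1X nX D (EFin \o v) &
    (N1norm nX D (fun x => u x - (v x)%:E) < e%:E)%E].

End metric_measure_notions.

(* Main.v *)
Require Import Defs.
From mathcomp Require Import all_boot all_order all_algebra.
From mathcomp Require Import all_classical all_reals all_analysis.
From mathcomp Require Import measurable_realfun.
From mathcomp Require Import lra.

(* Cut Omega into layers along the truncated distance rho to its complement: the
   functions [layer Omega j] are Lipschitz, add up to 1 on Omega, and each of
   them vanishes near the complement of Omega.  Hence u * layer j, extended by
   zero, belongs to N^1X of the whole space and is approximated there by a
   locally Lipschitz v_j.  Multiply v_j by a Lipschitz function [layer_cover j]
   equal to 1 on the support of layer j and to 0 where j * rho >= 3.  The sum of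
   the products is locally finite in Omega, hence locally Lipschitz, and the
   Riesz-Fischer property bounds the error by the sum of the errors of the v_j.
   The analytic ingredient is the product rule: if g is an upper gradient of f
   in the open set D, and eta is L-Lipschitz with values in [0, 1] and vanishes
   near the complement of D, then L |f| + g is an upper gradient of f * eta.  As
   f is only measurable, |f| has to be replaced by a Borel majorant equal to it
   almost everywhere. *)

Set Implicit Arguments.
Unset Strict Implicit.
Unset Printing Implicit Defensive.

Import Order.TTheory GRing.Theory Num.Theory.
Import numFieldTopology.Exports numFieldNormedType.Exports.

Local Open Scope classical_set_scope.
Local Open Scope ring_scope.

(** * Length of curves *)

Section polygonal_length.
Context {R : realType} {P : metricType R}.
Implicit Types (gamma : R -> P) (s : seq R).

(** The sum in [curve_length] without indices, so that it unfolds along the list of partition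
    points. *)
Definition polygonal_length gamma (a : R) s : R :=
  \sum_(p <- zip (a :: s) s) mdist (gamma p.1) (gamma p.2).

Lemma polygonal_length_nil gamma a : polygonal_length gamma a [::] = 0.
Proof. by rewrite /polygonal_length big_nil. Qed.

Lemma polygonal_length_cons gamma a x s :
  polygonal_length gamma a (x :: s) =
  mdist (gamma a) (gamma x) + polygonal_length gamma x s.
Proof. by rewrite /polygonal_length /= big_cons. Qed.

Lemma polygonal_length_cat gamma a s t :
  polygonal_length gamma a (s ++ t) =
  polygonal_length gamma a s + polygonal_length gamma (last a s) t.
Proof.
elim: s a => [|x s ih] a /=; first by rewrite polygonal_length_nil add0r.
by rewrite !polygonal_length_cons ih addrA.
Qed.

Lemma polygonal_length_shift gamma r a s :
  polygonal_length (fun x => gamma (r + x)) a s =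
  polygonal_length gamma (r + a) [seq r + x | x <- s].
Proof.
elim: s a => [|x s ih] a /=; first by rewrite !polygonal_length_nil.
by rewrite !polygonal_length_cons ih.
Qed.

Lemma curve_lengthE a b gamma : curve_length a b gamma =
  ereal_sup [set (polygonal_length gamma a s)%:E | s in itv_partition a b].
Proof.
congr ereal_sup; apply: eq_imagel => s _; congr EFin.
elim: s a => [|x s ih] a; first by rewrite polygonal_length_nil big_ord0.
by rewrite polygonal_length_cons -ih big_ord_recl.
Qed.

Lemma polygonal_length_le a b gamma s : itv_partition a b s ->
  ((polygonal_length gamma a s)%:E <= curve_length a b gamma)%E.
Proof. by move=> abs; rewrite curve_lengthE; apply: ereal_sup_ubound; exists s. Qed.

(** Inserting [c] into the partition does not decrease the polygonal length, by the triangle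
    inequality; the refined partition is then cut at [c]. *)
Lemma polygonal_length_split gamma a c b s :
  itv_partition a b s -> a <= c <= b -> exists s1 s2,
  [/\ itv_partition a c s1, itv_partition c b s2 &
      polygonal_length gamma a s <=
      polygonal_length gamma a s1 + polygonal_length gamma c s2].
Proof.
elim: s a => [|x s ih] a.
  move=> /itv_partition_nil <- /andP[ac ca].
  have <- : a = c by apply/eqP; rewrite eq_le ac.
  by exists [::], [::]; rewrite polygonal_length_nil addr0; split => //; split => /=.
move=> abs /andP[]; rewrite le_eqVlt => /predU1P[<- ab|ac cb].
  by exists [::], (x :: s); rewrite polygonal_length_nil add0r; split => //; split => /=.
have [cx|xc] := ltP c x.
  exists [:: c], (x :: s); split => //.
  - exact: itv_partition1.
  - by case: abs => /= /andP[_ xs] xb; split => //=; rewrite cx.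
  rewrite !polygonal_length_cons polygonal_length_nil addr0 addrA lerD2r.
  exact: metric_triangle.
have [|s1 [s2 [xs1 cs2 les]]] := ih _ (itv_partition_cons abs).
  by rewrite xc.
exists (x :: s1), s2; split => //.
  by case: abs xs1 => /= /andP[ax _] _ [xs1 s1c]; split => //=; rewrite ax.
by rewrite !polygonal_length_cons -addrA lerD2l.
Qed.

Lemma curve_length_shift gamma r a b :
  curve_length a b (fun x => gamma (r + x)) =
  curve_length (r + a) (r + b) gamma.
Proof.
have shiftP (q u v : R) (s : seq R) : itv_partition u v s ->
    itv_partition (q + u) (q + v) [seq q + x | x <- s].
  move=> [us /eqP uv]; split; last by rewrite last_map uv.
  by rewrite path_map; apply: sub_path us => x y /= xy; rewrite ltrD2l.
rewrite !curve_lengthE; congr ereal_sup; apply/seteqP; split => _ [s abs <-].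
  exists [seq r + x | x <- s]; first exact: shiftP.
  by rewrite polygonal_length_shift.
exists [seq - r + x | x <- s]; first by have := shiftP (- r) _ _ _ abs; rewrite !addKr.
rewrite polygonal_length_shift -map_comp; congr (polygonal_length _ _ _)%:E.
by rewrite map_id_in// => x _ /=; rewrite addNKr.
Qed.

End polygonal_length.

(** * Pieces of curves parametrized by arc length *)

Section arc_length_curve.
Context {R : realType} {P : metricType R}.
Variables (D : set P) (l : R) (gamma : R -> P).
Hypothesis gammaP : arc_length_curve D l gamma.

(** Length is additive at [s], and the lengths over [0, s] and [0, t] are known. Concatenating
    partitions gives one inequality, splitting them at [s] the other. *)
Lemma arc_length_curve_sub s t : 0 <= s -> s <= t -> t <= l ->
  curve_length s t gamma = (t - s)%:E.
Proof.
move=> s0 st tl; case: gammaP => _ _ _ len.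
have ls : curve_length 0 s gamma = s%:E by apply: len; rewrite in_itv/= s0 (le_trans st).
have lt : curve_length 0 t gamma = t%:E by apply: len; rewrite in_itv/= (le_trans s0).
apply/eqP; rewrite eq_le; apply/andP; split.
  rewrite [leLHS]curve_lengthE; apply: ge_ereal_sup => _ [q stq <-].
  rewrite lee_fin lerBrDl -lerBrDr -lee_fin -ls curve_lengthE.
  apply: ge_ereal_sup => _ [p sp <-]; rewrite lee_fin lerBrDr -lee_fin -lt.
  have <- : polygonal_length gamma 0 (p ++ q) =
      polygonal_length gamma 0 p + polygonal_length gamma s q.
    by rewrite polygonal_length_cat; case: sp => _ /eqP ->.
  by apply: polygonal_length_le; exact: itv_partition_cat sp stq.
rewrite EFinB leeBlDl// -lt curve_lengthE.
apply: ge_ereal_sup => _ [r tr <-].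
have [|p [q [sp stq le]]] := polygonal_length_split gamma (c := s) tr.
  by rewrite s0.
apply: (@le_trans _ _ (polygonal_length gamma 0 p + polygonal_length gamma s q)%:E).
  by rewrite lee_fin.
rewrite EFinD leeD//; last exact: polygonal_length_le.
by rewrite -ls; exact: polygonal_length_le.
Qed.

Lemma arc_length_curve_lip s t : 0 <= s -> s <= t -> t <= l ->
  mdist (gamma s) (gamma t) <= t - s.
Proof.
move=> s0; rewrite le_eqVlt => /predU1P[<- _|st tl]; first by rewrite mdistxx subrr.
rewrite -lee_fin -arc_length_curve_sub ?(ltW st)//.
apply: le_trans (polygonal_length_le gamma (itv_partition1 st)).
by rewrite polygonal_length_cons polygonal_length_nil addr0.
Qed.

Lemma arc_length_curve_dist s t : s \in `[0, l] -> t \in `[0, l] ->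
  mdist (gamma s) (gamma t) <= `|s - t|.
Proof.
rewrite !in_itv/= => /andP[s0 sl] /andP[t0 tl].
have [st|ts] := leP s t; first by rewrite ler0_norm ?opprB ?subr_le0// arc_length_curve_lip.
by rewrite gtr0_norm ?subr_gt0// metric_sym arc_length_curve_lip// ltW.
Qed.

(** Allows an upper gradient inequality in [D'] to be applied to a piece of a curve that elsewhere
    leaves [D']. *)
Lemma arc_length_subcurve (D' : set P) s t : 0 <= s -> s < t -> t <= l ->
  (forall x, s <= x <= t -> D' (gamma x)) ->
  arc_length_curve D' (t - s) (fun x => gamma (s + x)).
Proof.
move=> s0 st tl D'g.
have in0l x : x \in `[0, t - s] -> s + x \in `[0, l].
  by rewrite !in_itv/= => /andP[? ?]; apply/andP; split; lra.
split.
- by rewrite subr_gt0.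
- apply/subspace_continuousP => x /= xts; apply/metricType_numDomainType.cvgrPdist_lt => e e0.
  rewrite near_withinE; exists e => // y /= xy yts.
  apply: le_lt_trans (arc_length_curve_dist (in0l _ xts) (in0l _ yts)) _.
  by rewrite opprD addrACA subrr add0r.
- by move=> x; rewrite in_itv/= => /andP[? ?]; apply: D'g; apply/andP; split; lra.
- move=> x xts; have := in0l _ xts; move: xts; rewrite !in_itv/= => /andP[? ?] /andP[? ?].
  rewrite curve_length_shift addr0 arc_length_curve_sub//; last by lra.
  by congr EFin; lra.
Qed.

End arc_length_curve.

(** * Integrals along curves *)

Section translation.
Context {R : realType}.
Local Notation mu := (@lebesgue_measure R).

Lemma measurable_translation (r : R) :
  measurable_fun setT ((fun x => r + x) : measurableTypeR R -> measurableTypeR R).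
Proof. by apply: measurable_funD => //; exact: measurable_cst. Qed.

(** Lebesgue measure is determined by its values on half-open intervals. *)
Lemma lebesgue_measure_translation (r : R) (A : set R) : measurable A ->
  pushforward mu ((fun x => r + x) : measurableTypeR R -> measurableTypeR R) A = mu A.
Proof.
move=> mA; apply/esym/lebesgue_measure_unique => //=.
  exact: measurable_translation.
move=> _ _ [[a b]] _ <-; rewrite /pushforward/=.
have -> : (fun x => r + x) @^-1` `]a, b] = `]a - r, b - r]%classic.
  by apply/seteqP; split => x /=; rewrite !in_itv/= => /andP[? ?]; apply/andP; split; lra.
rewrite !lebesgue_measure_itv/= !lte_fin ltrD2r; case: ifPn => // _.
by rewrite -!EFinB; congr EFin; lra.
Qed.

Lemma ge0_integral_itv_translation (f : R -> \bar R) (s t : R) :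
  measurable_fun `[s, t] f -> (forall x, s <= x <= t -> (0 <= f x)%E) ->
  (\int[mu]_(x in `[0%R, (t - s)%R]) f (s + x)%R = \int[mu]_(x in `[s, t]) f x)%E.
Proof.
move=> mf f0.
have -> : `[0, t - s]%classic =
    ((fun x => s + x) : measurableTypeR R -> measurableTypeR R) @^-1` `[s, t].
  by apply/seteqP; split => x /=; rewrite !in_itv/= => /andP[? ?]; apply/andP; split; lra.
rewrite -(ge0_integral_pushforward (measurable_translation s))//; last first.
  by move=> x; rewrite inE/= in_itv/=; exact: f0.
apply: eq_measure_integral => [|mT A mA _]; first exact: measurable_translation.
exact: lebesgue_measure_translation.
Qed.

Lemma ge0_integral_itv_cat (f : R -> \bar R) (a b c : R) : a <= b -> b <= c ->
  measurable_fun `[a, c] f -> (forall x, a <= x <= c -> (0 <= f x)%E) ->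
  (\int[mu]_(x in `[a, c]) f x =
   \int[mu]_(x in `[a, b]) f x + \int[mu]_(x in `[b, c]) f x)%E.
Proof.
move=> ab bc mf f0.
have sub (u v : itv_bound R) : (BLeft a <= u)%O -> (v <= BRight c)%O ->
    [set` Interval u v] `<=` `[a, c].
  by move=> au vc; apply: subset_itv.
have acE : `[a, c]%classic = `[a, b] `|` `]b, c].
  by rewrite -itv_bndbnd_setU ?bnd_simp.
rewrite {1}acE ge0_integral_setU//=.
- congr (_ + _)%E; apply: integral_itv_obnd_cbnd.
  by apply: measurable_funS mf => //; apply: sub; rewrite bnd_simp.
- by move: mf; rewrite acE; exact.
- by move=> x xU; apply: f0; move: xU; rewrite !in_itv/= => -[/andP[]|/andP[]]; lra.
- apply/disj_setPS => x /= []; rewrite !in_itv/= => /andP[_ xb] /andP[bx _].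
  by move: (lt_le_trans bx xb); rewrite ltxx.
Qed.

End translation.

Section Borel.
Context {R : realType} {d : measure_display} {P : metricMeasurableType R d}.
Local Notation BP := (g_sigma_algebraType (@open P)).

(** Continuity controls preimages of Borel sets only, which is why integrands along curves are taken
    Borel on [P]. *)
Lemma measurable_arc_length_curve (D : set P) (l : R) (gamma : R -> P) :
  arc_length_curve D l gamma ->
  measurable_fun `[0, l] (gamma : R -> BP).
Proof.
move=> [l0 cg _ _]; move=> mI; apply: (measurability (@open P : set (set BP))) => //.
move=> _ [U oU <-].
have /open_subspaceP[V oV VU] : open (gamma @^-1` U : set (subspace `[0, l])).
  by move/continuousP : cg; apply.
rewrite setIC -VU; apply: measurableI => //.
exact: open_measurable.
Qed.

Lemma measurable_curve_integrand (D : set P) (l : R) (gamma : R -> P)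
    (k : P -> \bar R) :
  arc_length_curve D l gamma -> measurable_fun setT (k : BP -> \bar R) ->
  measurable_fun `[0, l] (k \o gamma).
Proof.
move=> /measurable_arc_length_curve mg mk.
exact: (measurableT_comp mk mg).
Qed.

End Borel.

(** * Borel majorants *)

Section Borel_hull.
Context {R : realType} {d : measure_display} {P : metricMeasurableType R d}.
Variable mu : {measure set P -> \bar R}.
Hypothesis mu_sigma_finite : sigma_finite setT mu.
Hypothesis muP : Borel_regular mu.
Local Notation BP := (g_sigma_algebraType (@open P)).

(** A hull of equal measure differs from the set by a null set when that measure is finite; so the
    hulls are taken of the pieces of [A] in a sigma-finite cover and then united. *)
Lemma Borel_hull (A : set P) : measurable A ->
  exists B : set P, [/\ Borel_set B, A `<=` B & mu (B `\` A) = 0%E].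
Proof.
case: muP => Bm hull mA.
have [F FT FP] := mu_sigma_finite.
have AF n : measurable (A `&` F n) by apply: measurableI => //; case: (FP n).
have /choice[B BnP] n : exists B : set P,
    [/\ Borel_set B, A `&` F n `<=` B & mu B = mu (A `&` F n)] by exact: hull.
exists (\bigcup_n B n); split.
- have : measurable (\bigcup_n B n : set BP).
    by apply: bigcup_measurable => n _; case: (BnP n).
  exact.
- move=> x Ax; have : [set: P] x by [].
  by rewrite FT => -[n _ Fnx]; exists n => //; case: (BnP n) => _ + _; apply.
apply/eqP; rewrite eq_le measure_ge0 andbT.
have mB n : measurable (B n) by apply: Bm; case: (BnP n).
have mD n : measurable (B n `\` (A `&` F n)) by exact: measurableD.
have sub : \bigcup_n B n `\` A `<=` \bigcup_n (B n `\` (A `&` F n)).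
  by move=> x [[n _ Bnx] nAx]; exists n => //; split => // -[].
apply: (@le_trans _ _ (mu (\bigcup_n (B n `\` (A `&` F n))))).
  apply: le_measure => //; rewrite inE; last exact: bigcup_measurable.
  by apply: measurableD => //; exact: bigcup_measurable.
apply: le_trans (@measure_sigma_subadditive _ _ _ mu _
  (fun n => B n `\` (A `&` F n)) _ _ _) _ => //.
  exact: bigcup_measurable.
rewrite eseries0// => n _ _.
have [_ ABn mBn] := BnP n.
have fin : (mu (A `&` F n) < +oo)%E.
  by rewrite (le_lt_trans _ (FP n).2)// le_measure// inE//; case: (FP n).
have finB : (mu (B n) < +oo)%E by rewrite mBn.
have E : (mu (B n `\` (A `&` F n)) = mu (B n) - mu (A `&` F n))%E.
  by rewrite -[in RHS](setIidr ABn); exact: measureD.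
by rewrite E mBn subee// ge0_fin_numE.
Qed.

(** With q running through the rationals, |u| is a supremum of constants q on the sets where |u| >
    q. Replacing these sets by Borel hulls makes the supremum Borel and changes it on a null set
    only. *)
Lemma Borel_majorant (u : P -> \bar R) : measurable_fun setT u ->
  exists h : P -> \bar R, [/\ measurable_fun setT (h : BP -> \bar R),
    forall x, (`|u x| <= h x)%E & {ae mu, forall x, h x = `|u x|%E}].
Proof.
move=> meas_u; pose q n : R := ratr (odflt 0%Q (unpickle n : option rat)).
have mA n : measurable [set x | ((q n)%:E < `|u x|)%E].
  have mabs : measurable_fun setT (fun x => `|u x|%E) by exact: measurableT_comp.
  by rewrite -[X in measurable X]setTI; exact: emeasurable_fun_o_infty.
have /choice[B BnP] n := Borel_hull (mA n).
pose f n : P -> \bar R := (cst (q n)%:E) \_ (B n).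
(* For this index [f n] vanishes identically, so the supremum is nonnegative. *)
have q0 : exists n, q n = 0.
  by exists (pickle (0%Q : rat)); rewrite /q pickleK /= raddf0.
have uh x : (`|u x| <= esups (f ^~ x) 0%N)%E.
  rewrite leNgt; apply/negP => hu.
  have fh n : (f n x <= esups (f ^~ x) 0%N)%E by apply: ereal_sup_ubound; exists n.
  have h0 : (0 <= esups (f ^~ x) 0%N)%E.
    have [n qn] := q0; apply: le_trans (fh n).
    by rewrite /f patchE/= qn; case: ifPn.
  (* For a rational strictly between the supremum and |u x|, the point x lies in [B n], so [f n x]
     exceeds the supremum. *)
  have [n /andP[hq qu]] : exists n, (esups (f ^~ x) 0%N < (q n)%:E < `|u x|)%E.
    case: (esups (f ^~ x) 0%N) h0 hu => [r r0 ru|_|//]; last by rewrite ltNge leey.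
    have [s rs su] : exists2 s : R, r < s & (s%:E <= `|u x|)%E.
      case: (`|u x|)%E ru => [s|_|//]; first by exists s.
      by exists (r + 1); rewrite ?ltrDl// leey.
    have [a] := rat_in_itvoo rs; rewrite in_itv/= => /andP[ra as_].
    exists (pickle a); rewrite /q pickleK/= lte_fin ra/=.
    by rewrite (lt_le_trans _ su).
  have := fh n; rewrite /f patchE mem_set/=; last first.
    by case: (BnP n) => _ + _; apply.
  by rewrite leNgt hq.
exists (fun x => esups (f ^~ x) 0%N); split.
- apply: measurable_fun_esups => n.
  apply/(@measurable_restrictT _ _ BP _ (B n)) => //.
  by case: (BnP n).
- exact: uh.
(* Off this countable union of null sets, x in [B n] forces q n < |u x|, so no [f n x] exceeds |u
   x|. *)
- exists (\bigcup_n (B n `\` [set x | ((q n)%:E < `|u x|)%E])); split.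
  + apply: bigcup_measurable => n _; apply: measurableD => //.
    by case: muP => + _; apply; case: (BnP n).
  + apply/eqP; rewrite eq_le measure_ge0 andbT.
    have mBA n : measurable (B n `\` [set x | ((q n)%:E < `|u x|)%E]).
      by apply: measurableD => //; case: muP => + _; apply; case: (BnP n).
    apply: le_trans (@measure_sigma_subadditive _ _ _ mu _
      (fun n => B n `\` [set x | ((q n)%:E < `|u x|)%E]) _ _ _) _ => //.
      exact: bigcup_measurable.
    by rewrite eseries0// => n _ _; case: (BnP n).
  + move=> x /= nE; apply: contrapT => nN; apply: nE.
    apply/eqP; rewrite eq_le uh andbT; apply: ge_ereal_sup => _ [n _ <-].
    rewrite /f patchE; case: ifPn => [/set_mem Bnx|_] /=; last exact: abse_ge0.
    rewrite leNgt; apply/negP => uq; apply: nN; exists n => //; split => //=.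
    by rewrite ltNge (ltW uq).
Qed.

End Borel_hull.

(** * The product rule *)

(* No finiteness assumption: if one of the points is infinite, the convention
   |oo - oo| = oo makes the right-hand side infinite. *)
Lemma abse_sub_triangle (R : realType) (y x z : \bar R) :
  (`|x - z| <= `|x - y| + `|y - z|)%E.
Proof.
case: x y z => [x| |] [y| |] [z| |] //=; rewrite ?leey// -EFinD lee_fin.
by rewrite (le_trans _ (ler_normD _ _))// subrKA.
Qed.

Section upper_gradient_mul.
Context {R : realType} {d : measure_display} {P : metricMeasurableType R d}.
Local Notation BP := (g_sigma_algebraType (@open P)).
Variables (D : set P) (f g h : P -> \bar R) (eta : P -> R) (L delta : R).
Hypotheses (oD : open D) (L0 : 0 <= L) (delta0 : 0 < delta).
Hypothesis eta01 : forall x, 0 <= eta x <= 1.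
Hypothesis eta_lip : forall x y, `|eta x - eta y| <= L * mdist x y.
Hypothesis etaD : forall x, eta x != 0 -> ball x delta `<=` D.
Hypothesis fg : upper_gradient D f g.
Hypothesis mh : measurable_fun setT (h : BP -> \bar R).
Hypothesis fh : forall x, (`|f x| <= h x)%E.

(** [g] is controlled on [D] only, whereas the curves run in the whole space; its extension by zero
    is Borel because [D] is open. *)
Let k x := (L%:E * h x + (g \_ D) x)%E.
Let feta x := (f x * (eta x)%:E)%E.

Let h0 x : (0 <= h x)%E. Proof. exact: le_trans (fh x). Qed.

Let gD0 x : (0 <= (g \_ D) x)%E.
Proof.
by rewrite patchE; case: ifPn => [/set_mem Dx|_]//; case: fg => _ + _; apply.
Qed.

Let k0 x : (0 <= k x)%E.
Proof. by rewrite adde_ge0// mule_ge0. Qed.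

Let mgD : measurable_fun setT (g \_ D : BP -> \bar R).
Proof.
apply/(@measurable_restrictT _ _ BP _ D); last by case: fg.
by apply: sub_sigma_algebra.
Qed.

Let mLh : measurable_fun setT ((fun x => L%:E * h x)%E : BP -> \bar R).
Proof. exact: measurable_funeM. Qed.

Let mk : measurable_fun setT (k : BP -> \bar R).
Proof. exact: emeasurable_funD. Qed.

Section curve.
Variables (l : R) (gamma : R -> P).
Hypothesis gammaP : arc_length_curve setT l gamma.
Local Notation mu := (@lebesgue_measure R).

Let sub0l (s t : R) : 0 <= s -> t <= l -> `[s, t] `<=` `[0, l].
Proof. by move=> s0 tl; apply: subset_itv; rewrite bnd_simp. Qed.

Let mint (u : P -> \bar R) s t : 0 <= s -> t <= l ->
  measurable_fun setT (u : BP -> \bar R) ->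
  measurable_fun `[s, t] (u \o gamma).
Proof.
move=> s0 tl meas_u; apply: measurable_funS (sub0l s0 tl) _ => //.
exact: measurable_curve_integrand gammaP _.
Qed.

Let K s t := (\int[mu]_(x in `[s, t]) k (gamma x))%E.

Let Kge0 s t : (0 <= K s t)%E.
Proof. by apply: integral_ge0 => x _; exact: k0. Qed.

(* On [s, t] the values of |f| differ from |f (gamma s)| by at most the integral
   of g, so replacing L |f (gamma s)| (t - s) by the integral of L h costs only
   L (t - s) times that integral, a relative error vanishing with the mesh. *)
Let step_in s t : 0 <= s -> s < t -> t <= l ->
  (forall x, s <= x <= t -> D (gamma x)) ->
  (`|feta (gamma s) - feta (gamma t)| <= (1 + L * (t - s))%:E * K s t)%E.
Proof.
move=> s0 st tl Dg.
pose G := (\int[mu]_(x in `[s, t]) (g \_ D) (gamma x))%E.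
pose H := (\int[mu]_(x in `[s, t]) h (gamma x))%E.
have H0 : (0 <= H)%E by apply: integral_ge0 => x _; exact: h0.
have G0 : (0 <= G)%E by apply: integral_ge0 => x _; exact: gD0.
have KE : K s t = (L%:E * H + G)%E.
  rewrite /K /k ge0_integralD//=; last 3 first.
  - by move=> x _; rewrite mule_ge0.
  - exact: (mint s0 tl mLh).
  - exact: (mint s0 tl mgD).
  by rewrite ge0_integralZl_EFin//; exact: (mint s0 tl mh).
(* The upper gradient inequality on the subcurve from [s] to [x], followed by enlarging the interval
   of integration to [s, t]. *)
have fG x : s < x <= t -> (`|f (gamma s) - f (gamma x)| <= G)%E.
  move=> /andP[sx xt]; have xl := le_trans xt tl.
  have Dsx y : s <= y <= x -> D (gamma y).
    by move=> /andP[sy yx]; apply: Dg; rewrite sy (le_trans yx).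
  have := arc_length_subcurve gammaP s0 sx xl Dsx.
  case: fg => _ _ /[apply]; rewrite addr0 subrKC => /le_trans; apply.
  rewrite /curve_integral.
  have -> : (\int[mu]_(y in `[0%R, (x - s)%R]) g (gamma (s + y)%R) =
      \int[mu]_(y in `[0%R, (x - s)%R]) (g \_ D) (gamma (s + y)%R))%E.
    apply: eq_integral => y; rewrite inE/= in_itv/= => /andP[y0 yx].
    by rewrite patchE mem_set//; apply: Dsx; apply/andP; split; lra.
  rewrite (ge0_integral_itv_translation (mint s0 xl mgD)); last first.
    by move=> y _; exact: gD0.
  apply: ge0_subset_integral => //=; first exact: (mint s0 tl mgD).
  by apply: subset_itv; rewrite bnd_simp.
have HE : H = (\int[mu]_(x in `[s, t]) h (gamma x))%E by [].
clearbody G H.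
have [Koo|Kfin] := eqVneq (K s t) +oo%E.
  by rewrite Koo gt0_muley ?leey// lte_fin ltr_pwDl// mulr_ge0// subr_ge0 ltW.
have {}Kfin : K s t \is a fin_num by rewrite ge0_fin_numE// lt_neqAle Kfin leey.
have GK : (G <= K s t)%E by rewrite KE leeDr// mule_ge0.
have Gfin : G \is a fin_num by rewrite ge0_fin_numE// (le_lt_trans GK)// ltey_eq Kfin.
have := fG t; rewrite st lexx => /(_ isT).
rewrite /feta.
have absf x : s <= x <= t -> (`|f (gamma s)| <= h (gamma x) + G)%E.
  move=> /andP[]; rewrite le_eqVlt => /predU1P[<- _|sx xt].
    by rewrite (le_trans (fh _))// leeDl.
  have fx := fG _ (introT andP (conj sx xt)).
  have := abse_sub_triangle (f (gamma x)) (f (gamma s)) 0%E.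
  rewrite !sube0 => /le_trans; apply; rewrite addeC leeD//.
(* An infinite value of f at either end would make |f (gamma s) - f (gamma t)| infinite by the
   convention, against its finite bound [G]. Hence both values are real. *)
case fsE : (f (gamma s)) absf => [a| |]; last 2 first.
  1,2: by move=> _; case: (f (gamma t)) => [?| |]/=; rewrite leye_eq => /eqP GE;
    move: Gfin; rewrite GE.
case ftE : (f (gamma t)) => [b| |]; last 2 first.
  1,2: by rewrite /= leye_eq => _ /eqP GE; move: Gfin; rewrite GE.
move=> absf; rewrite -(fineK Gfin) /= lee_fin => abG.
(* The bound |a| <= h (gamma x) + G, integrated over x in [s, t]. *)
have key : (((t - s) * `|a|)%:E <= H + ((t - s) * fine G)%:E)%E.
  have -> : (H + ((t - s) * fine G)%:E =
      \int[mu]_(x in `[s, t]) (h (gamma x) + G))%E.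
    rewrite ge0_integralD//=; [|exact: (mint s0 tl mh)]; rewrite HE.
    congr (_ + _)%E; rewrite integral_cst//= lebesgue_measure_itv/= lte_fin st.
    by rewrite -EFinB -[in RHS](fineK Gfin) -EFinM mulrC.
  have -> : (((t - s) * `|a|)%:E = \int[mu]_(x in `[s, t]) `|a|%:E)%E.
    rewrite integral_cst//= lebesgue_measure_itv/= lte_fin st.
    by rewrite -EFinB -EFinM mulrC.
  apply: ge0_le_integral => //=.
  by apply: emeasurable_funD => //; exact: (mint s0 tl mh).
(* The variation of [eta] costs at most L (t - s) |a|, that of f at most [G]. *)
apply: (@le_trans _ _ ((L * ((t - s) * `|a|))%:E + G)%E).
  rewrite -[in leRHS](fineK Gfin) -EFinD lee_fin.
  have -> : a * eta (gamma s) - b * eta (gamma t) =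
    a * (eta (gamma s) - eta (gamma t)) + (a - b) * eta (gamma t) by lra.
  rewrite (le_trans (ler_normD _ _))// lerD// normrM.
    rewrite [leRHS]mulrA [leRHS]mulrC ler_wpM2l//.
    rewrite (le_trans (eta_lip _ _))// ler_wpM2l//.
    by apply: (arc_length_curve_lip gammaP) => //; exact: ltW.
  have /andP[e0 e1] := eta01 (gamma t).
  by rewrite (ger0_norm e0) (le_trans _ abG)// ler_piMr.
rewrite EFinM.
apply: (@le_trans _ _ (L%:E * (H + ((t - s) * fine G)%:E) + G)%E).
  by rewrite leeD2r// lee_wpmul2l ?lee_fin.
have ts0 : 0 <= t - s by rewrite subr_ge0 ltW.
(* What exceeds K = L H + G is L (t - s) G, which is at most L (t - s) K. *)
rewrite ge0_muleDr ?lee_fin ?mulr_ge0 ?fine_ge0//.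
rewrite -addeA (addeC _ G) addeA -KE EFinD muleDl ?mul1e// leeD2l//.
rewrite -EFinM mulrA EFinM fineK// lee_wpmul2l// lee_fin mulr_ge0//.
Qed.

(** If [eta] vanishes at both ends, so does the product. Otherwise the piece, shorter than [delta],
    stays in the ball around an end where [eta] is nonzero, hence in [D]. *)
Let step s t : 0 <= s -> s < t -> t <= l -> t - s < delta ->
  (`|feta (gamma s) - feta (gamma t)| <= (1 + L * (t - s))%:E * K s t)%E.
Proof.
move=> s0 st tl std.
have [es|es] := eqVneq (eta (gamma s)) 0.
  have [et|et] := eqVneq (eta (gamma t)) 0.
    rewrite /feta es et !mule0 subee// abse0 mule_ge0// lee_fin addr_ge0//.
    by rewrite mulr_ge0// subr_ge0 ltW.
  apply: step_in => // x /andP[sx xt]; apply: (etaD et).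
  rewrite ballEmdist/= metric_sym.
  apply: (le_lt_trans (arc_length_curve_lip gammaP (le_trans s0 sx) xt tl)).
  by apply: le_lt_trans std; rewrite lerD2l lerN2.
apply: step_in => // x /andP[sx xt]; apply: (etaD es).
rewrite ballEmdist/=.
apply: (le_lt_trans (arc_length_curve_lip gammaP s0 sx (le_trans xt tl))).
by apply: le_lt_trans std; rewrite lerD2r.
Qed.

Let small_steps e : 0 < e -> e < delta ->
  (`|feta (gamma 0%R) - feta (gamma l)| <= (1 + L * e)%:E * K 0%R l)%E.
Proof.
move=> e0 edelta; have l0 : 0 < l by case: gammaP.
pose n := (Num.truncn (l / e)).+1.
have n0 : 0 < n%:R :> R by rewrite ltr0n.
have stepn : l / n%:R < e.
  rewrite ltr_pdivrMr// mulrC -ltr_pdivrMr//.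
  by rewrite truncnS_gt.
have stepn0 : 0 < l / n%:R by rewrite divr_gt0.
have Le0 : 0 <= 1 + L * e by rewrite addr_ge0// mulr_ge0// ltW.
(* The induction starts at one step: for zero steps the left side would be |oo - oo| = oo wherever
   the product is infinite. *)
have main m : (0 < m <= n)%N ->
    (`|feta (gamma 0%R) - feta (gamma (m%:R * (l / n%:R))%R)| <=
     (1 + L * e)%:E * K 0%R (m%:R * (l / n%:R))%R)%E.
  have pl j : (j <= n)%N -> j%:R * (l / n%:R) <= l.
    move=> jn; rewrite mulrCA ler_piMr ?(ltW l0)// ler_pdivrMr// mul1r.
    by rewrite ler_nat.
  have step' j : (j < n)%N ->
      (`|feta (gamma (j%:R * (l / n%:R))%R) - feta (gamma (j.+1%:R * (l / n%:R))%R)| <=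
       (1 + L * e)%:E * K (j%:R * (l / n%:R))%R (j.+1%:R * (l / n%:R))%R)%E.
    move=> jn.
    have jE : j.+1%:R * (l / n%:R) - j%:R * (l / n%:R) = l / n%:R.
      by rewrite -mulrBl -natrB// subSnn mul1r.
    apply: le_trans (step _ _ _ _) _.
    - by rewrite mulr_ge0// ltW.
    - by rewrite -subr_gt0 jE.
    - exact: pl.
    - by rewrite jE (lt_trans stepn).
    by rewrite jE lee_wpmul2r// lee_fin lerD2l ler_wpM2l// ltW.
  elim: m => // -[_ _|m ih /andP[_ mn]].
    by have := step' 0%N isT; rewrite mul0r.
  apply: le_trans (abse_sub_triangle (feta (gamma (m.+1%:R * (l / n%:R)))) _ _) _.
  rewrite /K (@ge0_integral_itv_cat _ _ 0 (m.+1%:R * (l / n%:R)))//.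
  - rewrite ge0_muleDr; [|exact: Kge0|exact: Kge0].
    by apply: leeD; [exact: (ih (ltnW mn))|exact: step'].
  - by rewrite mulr_ge0// ltW.
  - by rewrite ler_wpM2r ?ler_nat// ltW.
  - by apply: (mint (u := k)) => //; exact: pl.
have := main n; rewrite leqnn => /(_ isT).
by rewrite mulrC divfK ?gt_eqF.
Qed.

Lemma upper_gradient_mul_curve :
  (`|feta (gamma 0%R) - feta (gamma l)| <= K 0%R l)%E.
Proof.
have [->|Kfin] := eqVneq (K 0%R l) +oo%E; first by rewrite leey.
have {}Kfin : K 0%R l \is a fin_num by rewrite ge0_fin_numE// lt_neqAle Kfin leey.
apply/lee_addgt0Pr => e e0.
have c0 : 0 < L * fine (K 0%R l) + 1 by rewrite ltr_wpDl// mulr_ge0// fine_ge0.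
(* Makes r L K at most [e] and r smaller than [delta]; the added 1 keeps the denominator
   positive. *)
pose r := Num.min (delta / 2) (e / (L * fine (K 0%R l) + 1)).
have r0 : 0 < r by rewrite lt_min !divr_gt0.
have rd : r < delta by rewrite gt_min ltr_pdivrMr// ltr_pMr// ltr1n.
apply: (le_trans (small_steps r0 rd)).
rewrite -(fineK Kfin) -EFinM -EFinD lee_fin mulrDl mul1r lerD2l.
apply: (@le_trans _ _ (r * (L * fine (K 0%R l) + 1))).
  by rewrite mulrDr mulr1 [L * r]mulrC mulrA lerDl ltW.
by rewrite -ler_pdivlMr// ge_min lexx orbT.
Qed.

End curve.

Lemma upper_gradient_mul : upper_gradient setT
  (fun x => f x * (eta x)%:E)%E (fun x => L%:E * h x + (g \_ D) x)%E.
Proof.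
split; [exact: mk|by move=> x _; exact: k0|].
by move=> l gamma gammaP; exact: upper_gradient_mul_curve.
Qed.

End upper_gradient_mul.

(** * Lipschitz partition of unity *)

Section boundary_distance.
Context {R : realType} {P : metricType R}.
Variable O : set P.

(** The element 1 keeps the set nonempty when [O] is the whole space, and truncates the distance. *)
Let distances (x : P) : set R := [set 1] `|` [set mdist x y | y in ~` O].

Definition boundary_distance (x : P) : R := inf (distances x).

Let distances_lb x : lbound (distances x) 0.
Proof. by move=> _ [->|[y _ <-]]; rewrite ?mdist_ge0. Qed.

Let distances_inf x : has_inf (distances x).
Proof. by split; [exists 1; left|exists 0; exact: distances_lb]. Qed.

Lemma boundary_distance_ge0 x : 0 <= boundary_distance x.
Proof. by apply: lb_le_inf; [case: (distances_inf x)|exact: distances_lb]. Qed.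

Lemma boundary_distance_le1 x : boundary_distance x <= 1.
Proof. by apply: ge_inf; [case: (distances_inf x)|left]. Qed.

Lemma boundary_distance_le x y : ~ O y -> boundary_distance x <= mdist x y.
Proof. by move=> Oy; apply: ge_inf; [case: (distances_inf x)|right; exists y]. Qed.

Lemma boundary_distance_lip x y :
  `|boundary_distance x - boundary_distance y| <= mdist x y.
Proof.
wlog suff le : x y / boundary_distance x - boundary_distance y <= mdist x y.
  by rewrite ler_norml le andbT lerNl opprB metric_sym le.
rewrite lerBlDl -lerBlDr; apply: lb_le_inf; first by case: (distances_inf y).
move=> _ [->|[z Oz <-]]; rewrite lerBlDr.
  by rewrite (le_trans (boundary_distance_le1 x))// lerDl mdist_ge0.
rewrite (le_trans (boundary_distance_le x Oz))// addrC.
exact: metric_triangle.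
Qed.

Lemma ball_boundary_distance x : ball x (boundary_distance x) `<=` O.
Proof.
move=> y; rewrite ballEmdist/= => xy; apply: contrapT => Oy.
by move: (lt_le_trans xy (boundary_distance_le x Oy)); rewrite ltxx.
Qed.

Lemma boundary_distance_gt0 x : open O -> O x -> 0 < boundary_distance x.
Proof.
move=> oO Ox; have /nbhs_ballP[r /= r0 xrO] := open_nbhs_nbhs (conj oO Ox).
apply: (@lt_le_trans _ _ (Num.min 1 r)); first by rewrite lt_min ltr01.
apply: lb_le_inf; first by case: (distances_inf x).
move=> _ [->|[y Oy <-]]; rewrite ge_min ?lexx//; apply/orP; right.
by rewrite leNgt; apply/negP => xy; apply/Oy/xrO; rewrite ballEmdist.
Qed.

End boundary_distance.

Section clamp.
Context {R : realType}.
Implicit Types s t : R.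

Definition clamp01 t : R := Num.max 0 (Num.min 1 t).

Lemma clamp01_bounds t : 0 <= clamp01 t <= 1.
Proof. by rewrite /clamp01 le_max lexx/= ge_max ler01 ge_min lexx. Qed.

Lemma clamp01_le0 t : t <= 0 -> clamp01 t = 0.
Proof. by move=> t0; apply/max_idPl; rewrite ge_min t0 orbT. Qed.

Lemma clamp01_ge1 t : 1 <= t -> clamp01 t = 1.
Proof. by move=> t1; rewrite /clamp01 (min_idPl t1); apply/max_idPr. Qed.

Lemma clamp01_homo s t : s <= t -> clamp01 s <= clamp01 t.
Proof.
move=> st; rewrite /clamp01 ge_max le_max lexx/= le_max le_min !ge_min.
by rewrite lexx st !orbT.
Qed.

Lemma clamp01_lip s t : `|clamp01 s - clamp01 t| <= `|s - t|.
Proof.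
wlog st : s t / s <= t.
  by move=> H; have [/H//|/ltW/H] := leP s t; rewrite distrC (distrC t).
rewrite !ler0_norm ?subr_le0 ?clamp01_homo// !opprB /clamp01.
by case: (leP 1 s) => ?; case: (leP 1 t) => ?; rewrite !maxEle; do ?case: ifPn => ?; lra.
Qed.

End clamp.

Section cutoffs.
Context {R : realType} {P : metricType R}.
Variable O : set P.
Local Notation rho := (@boundary_distance R P O).

(** Equal to 0 where j rho <= 1 and to 1 where j rho >= 2. So [layer j] lives where (j + 1) rho > 1
    and j rho < 2, a region on which [layer_cover j] is 1. *)
Definition layer_sum (j : nat) (x : P) : R := clamp01 (j%:R * rho x - 1).
Definition layer (j : nat) (x : P) : R := layer_sum j.+1 x - layer_sum j x.
Definition layer_cover (j : nat) (x : P) : R := clamp01 (3 - j%:R * rho x).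

Lemma layer_sum_lip j x y :
  `|layer_sum j x - layer_sum j y| <= j%:R * mdist x y.
Proof.
apply: le_trans (clamp01_lip _ _) _.
rewrite opprB addrA subrK -mulrBr normrM ger0_norm//.
by rewrite ler_wpM2l// boundary_distance_lip.
Qed.

Lemma layer_lip j x y :
  `|layer j x - layer j y| <= (j.+1%:R + j%:R) * mdist x y.
Proof.
have -> : layer j x - layer j y = (layer_sum j.+1 x - layer_sum j.+1 y) -
  (layer_sum j x - layer_sum j y) by rewrite /layer; lra.
by rewrite (le_trans (ler_normB _ _))// mulrDl lerD// layer_sum_lip.
Qed.

Lemma layer_cover_lip j x y :
  `|layer_cover j x - layer_cover j y| <= j%:R * mdist x y.
Proof.
apply: le_trans (clamp01_lip _ _) _.
have -> : 3 - j%:R * rho x - (3 - j%:R * rho y) = - (j%:R * (rho x - rho y)) by lra.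
by rewrite normrN normrM ger0_norm// ler_wpM2l// boundary_distance_lip.
Qed.

Lemma layer_cover_bounds j x : 0 <= layer_cover j x <= 1.
Proof. exact: clamp01_bounds. Qed.

Lemma layer_bounds j x : 0 <= layer j x <= 1.
Proof.
have /andP[a0 _] : 0 <= layer_sum j x <= 1 := clamp01_bounds _.
have /andP[_ b1] : 0 <= layer_sum j.+1 x <= 1 := clamp01_bounds _.
have ab : layer_sum j x <= layer_sum j.+1 x.
  by apply: clamp01_homo; rewrite lerD2r ler_wpM2r ?ler_nat// boundary_distance_ge0.
by rewrite /layer; apply/andP; split; lra.
Qed.

(** A nonzero layer forces (j + 1) rho >= 1. This provides the distance [delta] in the product
    rule. *)
Lemma layer_ball j x : layer j x != 0 -> ball x j.+1%:R^-1 `<=` O.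
Proof.
move=> nz; apply: subset_trans (@ball_boundary_distance _ _ O x).
apply: le_ball; rewrite -[leLHS]mul1r ler_pdivrMr ?ltr0n// leNgt.
apply: contra nz => lt1; rewrite mulrC in lt1.
have le0 : (j%:R * rho x - 1 <= 0)%R.
  rewrite subr_le0 (le_trans _ (ltW lt1))// ler_wpM2r ?ler_nat//.
  exact: boundary_distance_ge0.
by rewrite /layer /layer_sum !clamp01_le0 ?subrr// subr_le0 ltW.
Qed.

(** Where the cover is below 1, j rho > 2, and the two partial sums defining the layer are both
    1. *)
Lemma layer_coverE j x : layer j x != 0 -> layer_cover j x = 1.
Proof.
move=> nz; apply: clamp01_ge1; rewrite leNgt.
apply: contra nz => lt1; have jr : (2 <= j%:R * rho x) by lra.
have jr1 : (2 <= j.+1%:R * rho x).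
  apply: le_trans jr _; rewrite ler_wpM2r ?ler_nat//.
  exact: boundary_distance_ge0.
by rewrite /layer /layer_sum !clamp01_ge1 ?subrr//; lra.
Qed.

Lemma layer_cover_eq0 j x : 3 <= j%:R * rho x -> layer_cover j x = 0.
Proof. by move=> j3; apply: clamp01_le0; lra. Qed.

Lemma sum_layer N x : 3 <= N%:R * rho x -> \sum_(0 <= j < N) layer j x = 1.
Proof.
move=> N3; rewrite telescope_sumr// {1}/layer_sum clamp01_ge1; last by lra.
by rewrite /layer_sum mul0r clamp01_le0 ?subr0//; lra.
Qed.

End cutoffs.

(** * Functions that are Lipschitz near a point *)

Section lipschitz_near.
Context {R : realType} {P : metricType R}.

Definition lipschitz_near (v : P -> R) (x : P) := exists U L,
  nbhs x U /\ forall y z, U y -> U z -> `|v y - v z| <= L * mdist y z.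

Lemma lipschitz_near_cst0 x : lipschitz_near (fun=> 0) x.
Proof.
exists setT, 0; split; first exact: filterT.
by move=> y z _ _; rewrite subrr normr0 mul0r.
Qed.

Lemma lipschitz_nearD u v x : lipschitz_near u x -> lipschitz_near v x ->
  lipschitz_near (fun y => u y + v y) x.
Proof.
move=> [U [L [xU uL]]] [V [M [xV vM]]]; exists (U `&` V), (L + M).
split; first exact: filterI.
move=> y z [Uy Vy] [Uz Vz]; rewrite opprD addrACA mulrDl.
by rewrite (le_trans (ler_normD _ _))// lerD ?uL ?vM.
Qed.

Lemma lipschitz_near_sum (v : nat -> P -> R) N x :
  (forall j, lipschitz_near (v j) x) ->
  lipschitz_near (fun y => \sum_(0 <= j < N) v j y) x.
Proof.
move=> vx; elim: N => [|N ih].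
  under [X in lipschitz_near X]eq_fun do rewrite big_geq//.
  exact: lipschitz_near_cst0.
under [X in lipschitz_near X]eq_fun do rewrite big_nat_recr//=.
exact: lipschitz_nearD.
Qed.

Lemma lipschitz_nearM (v z : P -> R) (M : R) x : 0 <= M ->
  (forall y, 0 <= z y <= 1) ->
  (forall y y', `|z y - z y'| <= M * mdist y y') ->
  lipschitz_near v x -> lipschitz_near (fun y => v y * z y) x.
Proof.
move=> M0 z01 zM [U [L [xU vL]]].
(* On the unit ball |v| is at most |v x| + |L|, and this multiplies the constant [M] of [z]. The
   absolute value covers a negative [L]. *)
exists (U `&` ball x 1), ((`|v x| + `|L|) * M + `|L|); split.
  by apply: filterI => //; exact: nbhsx_ballx.
have vL' y y' : U y -> U y' -> `|v y - v y'| <= `|L| * mdist y y'.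
  move=> Uy Uy'; apply: le_trans (vL _ _ Uy Uy') _.
  by rewrite ler_wpM2r ?mdist_ge0// ler_norm.
move=> y y' [Uy y1] [Uy' _].
have Ux := nbhs_singleton xU.
have vy : `|v y| <= `|v x| + `|L|.
  have -> : v y = v x + (v y - v x) by rewrite addrC subrK.
  rewrite (le_trans (ler_normD _ _))// lerD2l (le_trans (vL' _ _ Uy Ux))//.
  by rewrite ler_piMr// metric_sym; move: y1; rewrite ballEmdist => /ltW.
have -> : v y * z y - v y' * z y' = v y * (z y - z y') + (v y - v y') * z y' by lra.
rewrite (le_trans (ler_normD _ _))// [leRHS]mulrDl lerD// normrM.
  by rewrite -mulrA ler_pM.
have /andP[z0 z1] := z01 y'.
by rewrite (ger0_norm z0) (le_trans _ (vL' _ _ Uy Uy'))// ler_piMr.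
Qed.

End lipschitz_near.

(** * Operations on upper gradients *)

Section upper_gradients.
Context {R : realType} {d : measure_display} {P : metricMeasurableType R d}.
Local Notation BP := (g_sigma_algebraType (@open P)).

Lemma arc_length_curveW (D D' : set P) l (gamma : R -> P) : D `<=` D' ->
  arc_length_curve D l gamma -> arc_length_curve D' l gamma.
Proof. by move=> DD' [l0 cg Dg len]; split => // s /Dg /DD'. Qed.

(** As soon as one of the four values is infinite, so is a term on the right, since |oo - oo| =
    oo. *)
Lemma abse_subD_le (a A b B : \bar R) :
  (`|(a + A) - (b + B)| <= `|a - b| + `|A - B|)%E.
Proof.
case: a A b B => [a| |] [A| |] [b| |] [B| |] //=; rewrite ?leey// -EFinD lee_fin.
by rewrite opprD addrACA ler_normD.
Qed.

Lemma abse_sub_sum_le (a b : nat -> \bar R) N :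
  (`|\sum_(0 <= j < N) a j - \sum_(0 <= j < N) b j| <=
   \sum_(0 <= j < N) `|a j - b j|)%E.
Proof.
elim: N => [|N ih]; first by rewrite !big_geq// sube0 abse0.
rewrite !big_nat_recr//=; apply: le_trans (abse_subD_le _ _ _ _) _.
exact: leeD.
Qed.

(** Only the two ends of a curve matter, and one partial sum represents [F] at both. The integral of
    the series of the [k j] is the series of the integrals, by nonnegativity. *)
Lemma upper_gradient_series (D : set P) (F : P -> \bar R)
    (f k : nat -> P -> \bar R) : open D ->
  (forall j, upper_gradient setT (f j) (k j)) ->
  (forall x, D x -> exists N0, forall N, (N0 <= N)%N ->
     F x = (\sum_(0 <= j < N) f j x)%E) ->
  upper_gradient D F (fun x => \sum_(0 <= j <oo) k j x)%E.
Proof.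
move=> oD fk Ff.
have mk j : measurable_fun setT (k j : BP -> \bar R) by case: (fk j).
have k0 j x : (0 <= k j x)%E by case: (fk j) => _ + _; apply.
have mK : measurable_fun setT ((fun x => \sum_(0 <= j <oo) k j x)%E : BP -> \bar R).
  by apply: ge0_emeasurable_sum.
split.
- apply: measurable_funS mK => //.
- by move=> x _; apply: nneseries_ge0.
move=> l gamma gammaD; have gammaP := arc_length_curveW (@subsetT _ D) gammaD.
have [l0 _ Dg _] := gammaD.
have [N0 N0P] := Ff _ (Dg 0 (introT andP (conj (lexx 0) (ltW l0)))).
have [N1 N1P] := Ff _ (Dg l (introT andP (conj (ltW l0) (lexx l)))).
rewrite (N0P _ (leq_maxl N0 N1)) (N1P _ (leq_maxr N0 N1)).
apply: le_trans (abse_sub_sum_le _ _ _) _.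
rewrite /curve_integral integral_nneseries//; last first.
  by move=> n; exact: (measurable_curve_integrand gammaP (mk n)).
apply: (@le_trans _ _ (\sum_(0 <= j < maxn N0 N1) curve_integral l gamma (k j))%E).
  by apply: lee_sum => j _; case: (fk j) => _ _; exact.
by apply: nneseries_lim_ge => j _ _; apply: integral_ge0.
Qed.

(** Yields an upper gradient of the glued function from those of u and of the error u - v. The
    assumption is on differences because u - (u - v) need not give back v where u is infinite. *)
Lemma upper_gradient_le (D : set P) (u w v g k : P -> \bar R) : open D ->
  upper_gradient D u g -> upper_gradient D w k ->
  (forall x y, D x -> D y ->
    (`|v x - v y| <= `|u x - u y| + `|w x - w y|)%E) ->
  upper_gradient D v (fun x => g x + k x)%E.
Proof.
move=> oD [mg g0 gP] [mk k0 kP] uwv; split.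
- exact: emeasurable_funD.
- by move=> x Dx; rewrite adde_ge0 ?g0 ?k0.
move=> l gamma gammaP; have [l0 _ Dg _] := gammaP.
have D0 := Dg 0 (introT andP (conj (lexx 0) (ltW l0))).
have Dl := Dg l (introT andP (conj (ltW l0) (lexx l))).
apply: le_trans (uwv _ _ D0 Dl) _.
apply: le_trans (leeD (gP _ _ gammaP) (kP _ _ gammaP)) _.
have mcomp (p : P -> \bar R) : measurable_fun (D : set BP) (p : BP -> \bar R) ->
    measurable_fun `[0, l] (p \o gamma).
  move=> mp; apply: (measurable_comp (F := D : set BP)) => //.
  - exact: sub_sigma_algebra.
  - by move=> _ [s sl <-]; exact: Dg.
  - exact: measurable_arc_length_curve gammaP.
rewrite /curve_integral ge0_integralD//.
- by move=> x xl; apply: g0; exact: Dg.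
- exact: (mcomp g).
- by move=> x xl; apply: k0; exact: Dg.
- exact: (mcomp k).
Qed.

End upper_gradients.

(** * From Borel measurability to measurability for the measure *)

Section Borel_measurable.
Context {R : realType} {d : measure_display} {P : metricMeasurableType R d}.
Variable mu : {measure set P -> \bar R}.
Hypothesis muP : Borel_regular mu.
Local Notation BP := (g_sigma_algebraType (@open P)).

Lemma open_measurableP (D : set P) : open D -> measurable D.
Proof. by move=> oD; case: muP => + _; apply; exact: sub_sigma_algebra. Qed.

Lemma Borel_measurable_patch (D : set P) (g : P -> \bar R) : open D ->
  measurable_fun (D : set BP) (g : BP -> \bar R) ->
  measurable_fun setT (g \_ D).
Proof.
move=> oD mg; have mD : measurable (D : set BP) by exact: sub_sigma_algebra.
have mgD : measurable_fun setT ((g \_ D) : BP -> \bar R).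
  exact/(@measurable_restrictT _ _ BP _ D).
move=> _ Y mY; case: muP => + _; apply.
by have := mgD measurableT _ mY.
Qed.

Lemma lipschitz_measurable (f : P -> R) (L : R) :
  (forall x y, `|f x - f y| <= L * mdist x y) -> measurable_fun setT f.
Proof.
move=> fL; have cf : continuous f.
  move=> x; apply/cvgrPdist_lt => e e0.
  have L1 : 0 < `|L| + 1 by rewrite ltr_wpDl.
  apply/metricType_numDomainType.nbhs_mdistP; exists (e / (`|L| + 1)).
    by rewrite /= divr_gt0.
  move=> y /=; rewrite ltr_pdivlMr// => xy; apply: le_lt_trans xy.
  apply: le_trans (fL x y) _; rewrite mulrC ler_wpM2l ?mdist_ge0//.
  by rewrite (le_trans (ler_norm _))// lerDl.
move=> mT; apply: (measurability _ (RGenOpens.measurableE R)) => //.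
move=> _ [_ [a [b ->] <-]]; rewrite setTI; apply: open_measurableP.
by move/continuousP : cf; apply; exact: interval_open.
Qed.

End Borel_measurable.

(** * The Newtonian norm *)

Section Newtonian_norm.
Context {R : realType} {d : measure_display} {P : metricMeasurableType R d}.
Variables (mu : {measure set P -> \bar R}) (c : R) (nX : (P -> \bar R) -> \bar R).
Hypothesis muP : Borel_regular mu.
Hypothesis nXP : quasi_Banach_function_lattice mu c nX.
Local Notation BP := (g_sigma_algebraType (@open P)).

Lemma quasinorm_le (u v : P -> \bar R) :
  measurable_fun setT u -> measurable_fun setT v ->
  (forall x, (`|u x| <= `|v x|)%E) -> (nX u <= nX v)%E.
Proof. by move=> meas_u mv uv; apply: (qB_lattice nXP) => //; exact: aeW. Qed.

Lemma quasinorm_patch_ge0 (D : set P) (u g : P -> \bar R) : open D ->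
  upper_gradient D u g -> (0 <= nX (g \_ D))%E.
Proof.
move=> oD [mg _ _]; apply: (qB_ge0 nXP).
exact: (Borel_measurable_patch muP oD mg).
Qed.

(** Both summands of the norm are nonnegative, so each is below [a]; an infimum strictly below [a]
    is undercut by an actual upper gradient. *)
Lemma N1norm_lt (D : set P) (u : P -> \bar R) (a : \bar R) : open D ->
  measurable_fun setT (u \_ D) -> (N1norm nX D u < a)%E ->
  (nX (u \_ D) < a)%E /\
  exists2 g, upper_gradient D u g & (nX (g \_ D) < a)%E.
Proof.
move=> oD meas_u ua; have u0 := qB_ge0 nXP meas_u.
have inf0 : (0 <= ereal_inf [set nX (g \_ D) | g in upper_gradient D u])%E.
  apply: le_ereal_inf_tmp => _ [g ug <-]; exact: (quasinorm_patch_ge0 oD ug).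
split; first by apply: le_lt_trans ua; rewrite leeDl.
have /ereal_inf_lt[_ [g ug <-] ga] :
    (ereal_inf [set nX (g \_ D) | g in upper_gradient D u] < a)%E.
  by apply: le_lt_trans ua; rewrite leeDr.
by exists g.
Qed.

Lemma N1norm_le (D : set P) (u g : P -> \bar R) : upper_gradient D u g ->
  (N1norm nX D u <= nX (u \_ D) + nX (g \_ D))%E.
Proof. by move=> ug; apply: leeD => //; apply: ereal_inf_lbound; exists g. Qed.

Lemma N1_mul (D : set P) (f g : P -> \bar R) (eta : P -> R) (L delta : R) :
  sigma_finite setT mu -> open D -> 0 <= L -> 0 < delta ->
  (forall x, 0 <= eta x <= 1) ->
  (forall x y, `|eta x - eta y| <= L * mdist x y) ->
  (forall x, eta x != 0 -> ball x delta `<=` D) ->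
  measurable_fun setT f -> upper_gradient D f g ->
  exists2 k, upper_gradient setT (fun x => f x * (eta x)%:E)%E k &
    (nX k <= c%:E * (L%:E * nX f + nX (g \_ D)))%E.
Proof.
move=> mufin oD L0 delta0 eta01 etaL etaD mf fg.
have [h [mh fh hf]] := Borel_majorant mufin muP mf.
exists (fun x => L%:E * h x + (g \_ D) x)%E.
  exact: (upper_gradient_mul oD L0 delta0).
have mh' : measurable_fun setT h.
  rewrite -[h](patch_setT (fun=> point)); apply: (Borel_measurable_patch muP) => //.
  exact: openT.
have mLh : measurable_fun setT (fun x => L%:E * h x)%E by exact: measurable_funeM.
have mg : measurable_fun setT (g \_ D).
  by case: fg => mg _ _; exact: (Borel_measurable_patch muP oD mg).
apply: le_trans (qB_triangle nXP mLh mg) _.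
rewrite (qB_homogeneous nXP)// ger0_norm// lee_wpmul2l//.
  by rewrite lee_fin (le_trans _ (qB_concavity_ge1 nXP)).
(* The Borel majorant equals |f| almost everywhere, so its quasinorm is bounded by that of f. *)
rewrite leeD2r// lee_wpmul2l// ; apply: (qB_lattice nXP) => //.
by apply: filterS hf => x ->; rewrite abse_id.
Qed.

Lemma quasinorm_mul_le (f : P -> \bar R) (eta : P -> R) :
  measurable_fun setT f -> measurable_fun setT eta ->
  (forall x, 0 <= eta x <= 1) ->
  (nX (fun x => f x * (eta x)%:E)%E <= nX f)%E.
Proof.
move=> mf meta eta01; apply: quasinorm_le => // [|x].
  by apply: emeasurable_funM => //; exact/measurable_EFinP.
have /andP[l0 l1] := eta01 x.
rewrite abseM (gee0_abs (x := (eta x)%:E)) ?lee_fin//.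
by rewrite -[leRHS]mule1 lee_wpmul2l// lee_fin.
Qed.

Lemma quasinorm_add_fin (a b : P -> \bar R) :
  measurable_fun setT a -> measurable_fun setT b ->
  (nX a < +oo)%E -> (nX b < +oo)%E -> (nX (fun x => a x + b x)%E < +oo)%E.
Proof.
move=> ma mb afin bfin; apply: le_lt_trans (qB_triangle nXP ma mb) _.
rewrite lte_mul_pinfty ?lee_fin ?(le_trans ler01 (qB_concavity_ge1 nXP))//.
exact: lte_add_pinfty.
Qed.

(** The weights e / 2^(j+1) sum to [e], once the powers of [c] from the Riesz-Fischer property are
    absorbed in the terms. *)
Lemma quasinorm_series_le (a : nat -> P -> \bar R) (e : R) : 0 <= e ->
  (forall j, measurable_fun setT (a j)) -> (forall j x, (0 <= a j x)%E) ->
  (forall j, ((c ^+ j.+1)%:E * nX (a j) <= (e / (2 ^ j.+1)%:R)%:E)%E) ->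
  (nX (fun x => \sum_(0 <= j <oo) a j x) <= e%:E)%E.
Proof.
move=> e0 ma a0 ae; apply: le_trans (qB_Riesz_Fischer nXP ma _) _.
  by move=> j; exact: aeW.
apply: le_trans (epsilon_trick0 xpredT e0).
apply: lee_nneseries => [j _ _|j _]; last exact: ae.
rewrite mule_ge0 ?(qB_ge0 nXP)// lee_fin exprn_ge0//.
exact: le_trans (qB_concavity_ge1 nXP).
Qed.

Lemma N1X_mul (D : set P) (f g : P -> \bar R) (eta : P -> R) (L delta : R) :
  sigma_finite setT mu -> open D -> 0 <= L -> 0 < delta ->
  (forall x, 0 <= eta x <= 1) ->
  (forall x y, `|eta x - eta y| <= L * mdist x y) ->
  (forall x, eta x != 0 -> ball x delta `<=` D) ->
  measurable_fun setT f -> upper_gradient D f g ->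
  (nX f < +oo)%E -> (nX (g \_ D) < +oo)%E ->
  N1X nX setT (fun x => f x * (eta x)%:E)%E.
Proof.
move=> mufin oD L0 delta0 eta01 etaL etaD mf fg ffin gfin.
have meta := lipschitz_measurable muP etaL.
split; first by apply: emeasurable_funM => //; exact/measurable_EFinP.
have [k fk kle] := N1_mul mufin oD L0 delta0 eta01 etaL etaD mf fg.
apply: le_lt_trans (N1norm_le fk) _; rewrite !patch_setT.
apply: lte_add_pinfty; first exact: le_lt_trans (quasinorm_mul_le mf meta eta01) _.
apply: le_lt_trans kle _.
rewrite lte_mul_pinfty ?lee_fin ?(le_trans ler01 (qB_concavity_ge1 nXP))//.
by apply: lte_add_pinfty => //; rewrite lte_mul_pinfty ?lee_fin.
Qed.

End Newtonian_norm.

(** * Gluing the approximations *)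

Section gluing.
Context {R : realType} {d : measure_display} {P : metricMeasurableType R d}.
Variables (O : set P) (v_ : nat -> P -> R).
Hypothesis oO : open O.
Local Notation rho := (boundary_distance O).

Let term j x := v_ j x * layer_cover O j x.

(** At a point of [O] the number of summands exceeds 3 / rho x, and all later terms vanish there:
    this is the whole series, written as a finite sum whose length depends on the point. *)
Definition glue (x : P) : R :=
  \sum_(0 <= j < (Num.truncn (3 / rho x)).+1) term j x.

Lemma sum_term_stable M N x : 3 <= N%:R * rho x -> (N <= M)%N ->
  \sum_(0 <= j < M) term j x = \sum_(0 <= j < N) term j x.
Proof.
move=> N3 NM; rewrite (big_cat_nat (leq0n N) NM)//= [X in _ + X]big_nat [X in _ + X]big1 ?addr0//.
move=> j /andP[Nj _]; rewrite /term layer_cover_eq0 ?mulr0//.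
by apply: le_trans N3 _; rewrite ler_wpM2r ?ler_nat// boundary_distance_ge0.
Qed.

Lemma glueE N x : O x -> 3 <= N%:R * rho x ->
  glue x = \sum_(0 <= j < N) term j x.
Proof.
move=> Ox N3; have r0 := boundary_distance_gt0 oO Ox; rewrite /glue.
set M := (Num.truncn _).+1.
have M3 : 3 <= M%:R * rho x by rewrite -ler_pdivrMr// ltW// truncnS_gt.
have [NM|/ltnW MN] := leqP N M; first exact: sum_term_stable.
by rewrite (sum_term_stable M3 MN).
Qed.

Lemma cover_index (r : R) : 0 < r -> exists N : nat, 3 <= N%:R * r.
Proof.
move=> r0; exists (Num.truncn (3 / r)).+1.
by rewrite -ler_pdivrMr// ltW// truncnS_gt.
Qed.

Lemma cover_indexS (x : P) M N : 3 <= M%:R * rho x -> (M <= N)%N -> 3 <= N%:R * rho x.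
Proof.
move=> M3 MN; apply: le_trans M3 _.
by rewrite ler_wpM2r ?ler_nat// boundary_distance_ge0.
Qed.

(** On the ball of radius rho x / 2 around x, rho stays above rho x / 2, so one length [N] serves
    the whole ball and [glue] is there a fixed finite sum. *)
Lemma locally_Lipschitz_glue :
  (forall j, locally_Lipschitz setT (v_ j)) -> locally_Lipschitz O glue.
Proof.
move=> vL x Ox; have r0 := boundary_distance_gt0 oO Ox.
have [N N3] := cover_index (divr_gt0 r0 (ltr0n _ 2)).
have [|U [L [xU UL]]] := @lipschitz_near_sum _ _ term N x.
  move=> j; apply: (lipschitz_nearM (M := j%:R)) => //.
  - exact: layer_cover_bounds.
  - exact: layer_cover_lip.
  - have [U [L [xU UL]]] := vL j x I.
    by exists U, L; split => // y z Uy Uz; apply: UL.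
exists (U `&` ball x (rho x / 2)), L; split.
  by apply: filterI => //; apply: nbhsx_ballx; rewrite divr_gt0.
have glueU y : O y -> ball x (rho x / 2) y -> glue y = \sum_(0 <= j < N) term j y.
  move=> Oy; rewrite ballEmdist/= => xy; apply: glueE => //.
  apply: le_trans N3 _; rewrite ler_wpM2l//.
  have := boundary_distance_lip O x y; rewrite ler_norml => /andP[_ le].
  by move: (le_lt_trans le xy); lra.
move=> y z [Oy [Uy xy]] [Oz [Uz xz]].
by rewrite !glueU//; exact: UL.
Qed.

(** At each point of [O] the partial sums are eventually constant, so [glue] is their pointwise
    limit. *)
Lemma measurable_glue (mu : {measure set P -> \bar R}) :
  Borel_regular mu -> (forall j, measurable_fun setT (v_ j)) ->
  measurable_fun O (EFin \o glue).
Proof.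
move=> muP mv.
apply: (emeasurable_fun_cvg (fun N x => (\sum_(0 <= j < N) term j x)%:E)).
  move=> N; apply/measurable_EFinP; apply: measurable_sum => j.
  apply: measurable_funM.
    exact: measurable_funS (mv j).
  apply: measurable_funS measurableT (@subsetT _ _) _.
  exact: (lipschitz_measurable muP (@layer_cover_lip _ _ O j)).
move=> x Ox; have [N N3] := cover_index (boundary_distance_gt0 oO Ox).
apply: cvg_near_cst; exists N => // M /= NM; congr EFin.
by rewrite (glueE Ox (cover_indexS N3 NM)).
Qed.

End gluing.

(** * Density of locally Lipschitz functions on the open subset *)

Theorem theorem5p4 (R : realType) (d : measure_display)
    (P : metricMeasurableType R d)
    (mu : {sigma_finite_measure set P -> \bar R})
    (c : R) (nX : (P -> \bar R) -> \bar R) (Omega : set P) :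
  Borel_regular mu ->
  balls_finite_positive mu ->
  proper_space P ->
  open Omega ->
  quasi_Banach_function_lattice mu c nX ->
  absolutely_continuous_quasinorm mu nX ->
  (forall E : set P, measurable E -> (mu E < +oo)%E ->
     (nX (EFin \o \1_E) < +oo)%E) ->
  locally_Lipschitz_dense nX setT ->
  locally_Lipschitz_dense nX Omega.
Proof.
move=> muP _ _ oO nXP _ _ dense u [meas_u ufin] e e0.
have mufin : sigma_finite setT mu := sigma_finiteT mu.
have mO : measurable Omega := open_measurableP muP oO.
have c0 : 0 < c := lt_le_trans ltr01 (qB_concavity_ge1 nXP).
pose u0 : P -> \bar R := u \_ Omega.
have mu0 : measurable_fun setT u0 by exact/(measurable_restrictT u mO).
have [u0fin [g ug gfin]] := N1norm_lt muP nXP oO mu0 ufin.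
(* Curves in [Omega] see only the values on [Omega], so [g] also serves the extension by zero. *)
have u0g : upper_gradient Omega u0 g.
  case: ug => mg g0 gP; split => // l gamma gammaP.
  have [l0 _ Dg _] := gammaP; rewrite /u0 !patchE !mem_set; first exact: gP.
    by apply: Dg; rewrite in_itv/= lexx ltW.
  by apply: Dg; rewrite in_itv/= lexx ltW.
(* The upper gradient of the j-th error has quasinorm at most c (j + 1) eps j,
   which Riesz-Fischer multiplies by c ^ (j + 1). *)
pose eps j : R := (e / 4) / (2 ^ j.+1)%:R / (c ^+ j.+2 * j.+1%:R).
have eps0 j : 0 < eps j.
  by rewrite /eps !divr_gt0// ?ltr0n ?expn_gt0// mulr_gt0// exprn_gt0.
have epsE j : c ^+ j.+2 * j.+1%:R * eps j = (e / 4) / (2 ^ j.+1)%:R.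
  by rewrite /eps mulrC divfK// gt_eqF// mulr_gt0// exprn_gt0.
pose w j x := (u0 x * (layer Omega j x)%:E)%E.
have layer_cover_measurable j : measurable_fun setT (layer_cover Omega j).
  exact: (lipschitz_measurable muP (@layer_cover_lip _ _ Omega j)).
have wN1 j : N1X nX setT (w j).
  apply: (@N1X_mul _ _ _ _ _ _ muP nXP Omega u0 g (layer Omega j)
    (j.+1%:R + j%:R) j.+1%:R^-1) => //.
  - exact: layer_bounds.
  - exact: layer_lip.
  - exact: layer_ball.
have approx j : exists vk : (P -> R) * (P -> \bar R),
    [/\ locally_Lipschitz setT vk.1, measurable_fun setT (EFin \o vk.1),
      upper_gradient setT
        (fun x => (w j x - (vk.1 x)%:E) * (layer_cover Omega j x)%:E)%E vk.2,
      (nX (fun x => (w j x - (vk.1 x)%:E) * (layer_cover Omega j x)%:E)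
        <= (eps j)%:E)%E &
      (nX vk.2 <= (c * j.+1%:R * eps j)%:E)%E].
  have [v [vL [mv _] ve]] := dense _ (wN1 j) _ (eps0 j).
  pose F x := (w j x - (v x)%:E)%E.
  have mF : measurable_fun setT F.
    by apply: emeasurable_funB => //; case: (wN1 j).
  have [Fe [gF Fg gFe]] : (nX (F \_ setT) < (eps j)%:E)%E /\
      exists2 g, upper_gradient setT F g & (nX (g \_ setT) < (eps j)%:E)%E.
    by apply: (N1norm_lt muP nXP) => //; rewrite ?patch_setT//; exact: openT.
  rewrite !patch_setT in Fe gFe.
  (* The open set is now the whole space, so the distance 1 is an arbitrary choice. With Lipschitz
     constant j the bound becomes c (j eps + eps). *)
  have [|||||||k Fk kle] := @N1_mul _ _ _ _ _ _ muP nXP setT F gF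
    (layer_cover Omega j) j%:R 1 mufin openT.
  - by [].
  - by [].
  - exact: layer_cover_bounds.
  - exact: layer_cover_lip.
  - by [].
  - exact: mF.
  - exact: Fg.
  exists (v, k); split => //=.
    apply: le_trans (ltW Fe); apply: (quasinorm_mul_le nXP) => //.
    exact: layer_cover_bounds.
  apply: le_trans kle _; rewrite patch_setT.
  rewrite -mulrA EFinM lee_wpmul2l ?lee_fin ?(ltW c0)//.
  rewrite -addn1 natrD mulrDl mul1r EFinD EFinM leeD ?(ltW gFe)//.
  by rewrite lee_wpmul2l ?lee_fin// ltW.
have {approx}[vk vkP] := choice approx.
pose v_ j := (vk j).1; pose k j := (vk j).2.
pose f j x := ((w j x - (v_ j x)%:E) * (layer_cover Omega j x)%:E)%E.
have vL j : locally_Lipschitz setT (v_ j) by case: (vkP j).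
have mv j : measurable_fun setT (v_ j).
  by apply/measurable_EFinP; case: (vkP j).
have fk j : upper_gradient setT (f j) (k j) by case: (vkP j).
have fe j : (nX (f j) <= (eps j)%:E)%E by case: (vkP j).
have ke j : (nX (k j) <= (c * j.+1%:R * eps j)%:E)%E by case: (vkP j).
pose v := glue Omega v_.
have mvO : measurable_fun Omega (EFin \o v) := measurable_glue oO muP mv.
(* The cover is 1 wherever the layer is nonzero, so it leaves [w j] unchanged; where the layer is 0,
   [w j] is 0 even if u is infinite. *)
have fE j x : Omega x ->
    f j x = (u x * (layer Omega j x)%:E + - (v_ j x * layer_cover Omega j x)%:E)%E.
  move=> Ox; rewrite /f /w /u0 patchE mem_set//.
  have [->|nz] := eqVneq (layer Omega j x) 0.
    by rewrite mule0 !add0e -EFinN -EFinM mulNr.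
  by rewrite layer_coverE// mule1 mulr1.
have uvE N x : Omega x -> 3 <= N%:R * boundary_distance Omega x ->
    (u x - (v x)%:E = \sum_(0 <= j < N) f j x)%E.
  move=> Ox N3; rewrite /v (glueE v_ oO Ox N3).
  under [RHS]eq_bigr do rewrite fE//.
  (* The value u x may be infinite; it factors out of the sum because the layers are nonnegative. *)
  rewrite big_split/= -ge0_sume_distrr; last first.
    by move=> j _; rewrite lee_fin; case/andP: (layer_bounds Omega j x).
  rewrite sumEFin sum_layer// mule1; congr (_ + _)%E.
  by rewrite sumEFin sumrN.
have uv_ev x : Omega x -> exists N0, forall N, (N0 <= N)%N ->
    (u x - (v x)%:E = \sum_(0 <= j < N) f j x)%E.
  move=> Ox; have [N N3] := cover_index (boundary_distance_gt0 oO Ox).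
  by exists N => M NM; apply: uvE => //; exact: cover_indexS N3 NM.
(* [K] is to be an upper gradient of u - v on [Omega], and [S] a pointwise majorant of |u - v|. *)
pose K x := (\sum_(0 <= j <oo) k j x)%E.
pose S x := (\sum_(0 <= j <oo) `|f j x|)%E.
have uvK : upper_gradient Omega (fun x => u x - (v x)%:E)%E K.
  exact: upper_gradient_series oO fk uv_ev.
have mf j : measurable_fun setT (f j).
  apply: emeasurable_funM; last exact/measurable_EFinP.
  by apply: emeasurable_funB; [case: (wN1 j)|exact/measurable_EFinP].
have mk j : measurable_fun setT (k j).
  rewrite -[k j](patch_setT (fun=> point)).
  by case: (fk j) => mkj _ _; exact: (Borel_measurable_patch muP openT mkj).
have k0 j x : (0 <= k j x)%E by case: (fk j) => _ + _; apply.
have mfabs j : measurable_fun setT (fun x => `|f j x|%E) by exact: measurableT_comp.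
have mS : measurable_fun setT S by exact: ge0_emeasurable_sum.
have mK : measurable_fun setT K by exact: ge0_emeasurable_sum.
have Se : (nX S <= (e / 4)%:E)%E.
  apply: (quasinorm_series_le nXP) => // [|j]; first by rewrite divr_ge0// ltW.
  have fabs : (nX (fun x => `|f j x|%E) <= (eps j)%:E)%E.
    by apply: le_trans (fe j); apply: (quasinorm_le nXP) => // x; rewrite abse_id.
  apply: le_trans (lee_wpmul2l _ fabs) _.
    by rewrite lee_fin exprn_ge0// ltW.
  rewrite -EFinM lee_fin -epsE ler_wpM2r ?(ltW (eps0 j))//.
  (* The surplus factor c (j + 1) in [epsE], meant for the upper gradients, is at least 1. *)
  rewrite [in leRHS]exprSr -mulrA ler_peMr ?exprn_ge0 ?(ltW c0)//.
  by rewrite mulr_ege1 ?ler1n// (qB_concavity_ge1 nXP).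
have Ke : (nX K <= (e / 4)%:E)%E.
  apply: (quasinorm_series_le nXP) => // [|j]; first by rewrite divr_ge0// ltW.
  apply: le_trans (lee_wpmul2l _ (ke j)) _.
    by rewrite lee_fin exprn_ge0// ltW.
  by rewrite -EFinM lee_fin -epsE [in leRHS]exprSr !mulrA.
pose uv : P -> \bar R := fun x => (u x - (v x)%:E)%E.
have muv : measurable_fun setT (uv \_ Omega).
  by apply/(measurable_restrictT uv mO); exact: emeasurable_funB.
have uvS : (nX (uv \_ Omega) <= nX S)%E.
  apply: (quasinorm_le nXP) => // x.
  have S0 : (0 <= S x)%E by apply: nneseries_ge0.
  rewrite (gee0_abs S0) patchE; case: ifPn => [/set_mem Ox|_]; last by rewrite abse0.
  have [N /(_ N (leqnn N)) uvN] := uv_ev x Ox.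
  rewrite /uv uvN; apply: le_trans (lee_abs_sum _ _ _) _.
  by apply: nneseries_lim_ge => j _ _; exact: abse_ge0.
have KO : (nX (K \_ Omega) <= nX K)%E.
  apply: (quasinorm_le nXP) => //.
    by apply/(measurable_restrictT K mO); exact: measurable_funS mK.
  by move=> x; rewrite patchE; case: ifPn; rewrite // abse0 abse_ge0.
have uvfin : (nX (uv \_ Omega) < +oo)%E.
  by rewrite (le_lt_trans uvS)// (le_lt_trans Se)// ltry.
have KOfin : (nX (K \_ Omega) < +oo)%E.
  by rewrite (le_lt_trans KO)// (le_lt_trans Ke)// ltry.
exists v; split.
- exact: locally_Lipschitz_glue.
(* Membership of v in the Newtonian space comes from u and u - v. If x or y is infinite, the
   right-hand side is infinite. *)
- have abs3 (a b : R) (x y : \bar R) :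
      (`|a%:E - b%:E| <= `|x - y| + `|(x - a%:E) - (y - b%:E)|)%E.
    case: x y => [x| |] [y| |] //=; rewrite ?leey// -EFinD lee_fin.
    have -> : a - b = (x - y) - ((x - a) - (y - b)) by lra.
    exact: ler_normB.
  split => //; have vgK := upper_gradient_le (v := EFin \o v) oO ug uvK
    (fun x y _ _ => abs3 _ _ _ _).
  have mgO : measurable_fun setT (g \_ Omega).
    by case: ug => mg _ _; exact: (Borel_measurable_patch muP oO mg).
  have mvO' : measurable_fun setT ((EFin \o v) \_ Omega).
    exact/(measurable_restrictT _ mO).
  have mKO : measurable_fun setT (K \_ Omega).
    by apply/(measurable_restrictT K mO); exact: measurable_funS mK.
  apply: le_lt_trans (N1norm_le nX vgK) _; apply: lte_add_pinfty.
    have mabs (a : P -> \bar R) : measurable_fun setT a ->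
        measurable_fun setT (fun x => `|a x|%E) by move=> ma; exact: measurableT_comp.
    apply: le_lt_trans (quasinorm_add_fin nXP (mabs _ mu0) (mabs _ muv) _ _).
    + apply: (quasinorm_le nXP) => // [|x].
        by apply: emeasurable_funD; exact: mabs.
      rewrite (gee0_abs (adde_ge0 (abse_ge0 _) (abse_ge0 _))) /u0 !patchE.
      case: ifPn => _; last by rewrite leeDl// abse_ge0.
      (* Comparison with zero turns the inequality into |v| <= |u| + |u - v|. *)
      by have := abs3 (v x) 0 (u x) 0%E; rewrite !sube0.
    + apply: le_lt_trans u0fin; apply: (quasinorm_le nXP) => // [|x].
        exact: mabs.
      by rewrite abse_id.
    + apply: le_lt_trans uvfin; apply: (quasinorm_le nXP) => // [|x].
        exact: mabs.
      by rewrite abse_id.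
  apply: le_lt_trans (quasinorm_add_fin nXP mgO mKO gfin KOfin).
  have mgK : measurable_fun setT ((fun x => g x + K x)%E \_ Omega).
    apply/(measurable_restrictT _ mO); apply: emeasurable_funD.
      exact/(measurable_restrictT _ mO).
    exact: measurable_funS mK.
  apply: (quasinorm_le nXP mgK (emeasurable_funD mgO mKO)) => x.
  rewrite !patchE; case: ifPn => // _.
  (* Off [Omega] all three restrictions take the default value of the extended reals, which is 0. *)
  by rewrite (_ : point = 0%E :> \bar R)// adde0.
- apply: le_lt_trans (N1norm_le nX uvK) _.
  apply: (@le_lt_trans _ _ ((e / 4)%:E + (e / 4)%:E)%E).
    by apply: leeD; [exact: le_trans uvS Se|exact: le_trans KO Ke].
  by rewrite -EFinD lte_fin; lra.
Qed.
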